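(* Let $(A,\mathcal{A})$ be a standard Borel space and let $X_1^n=(X_1,\ldots,X_n)$ be an exchangeable vector of random variables $X_i$ with values in $(A,\mathcal{A})$ and with joint law $P_{X_1^n}$. For every $1\leq k\leq n-1$ there exists a probability measure $\mu=\mu_{k,n}$ on $\mathcal{M}_1(A)$ such that $$D\big(P_{X_1^k}\,\big\|\,M_{k,\mu}\big)\leq \frac{1}{n-k+1}\sum_{i=1}^k I(X_1^{i-1};X_k^n).$$
   Context: A random vector $(X_1,\ldots,X_n)$ is exchangeable if it has the same distribution as $(X_{\pi(1)},\ldots,X_{\pi(n)})$ for every permutation $\pi$ of $\{1,\ldots,n\}$. For $i\le j$ write $X_i^j=(X_i,X_{i+1},\ldots,X_j)$; $X_1^0$ is understood as a constant (so $I(X_1^0;X_k^n)=0$). $P_X$ denotes the law of $X$. A measurable space $(A,\mathcal{A})$ is standard Borel if there exists a complete separable metric space whose Borel $\sigma$-algebra is isomorphic to $\mathcal{A}$. $\mathcal{M}_1(A)$ denotes the space of probability measures on $(A,\mathcal{A})$, equipped with the smallest $\sigma$-algebra $\mathcal{F}$ that makes all the maps $\pi_F:\mathcal{M}_1(A)\to[0,1]$, $\pi_F(P)=P(F)$, $F\in\mathcal{A}$, measurable. For a probability measure $\mu$ on $(\mathcal{M}_1(A),\mathcal{F})$ and $k\geq 1$, the mixture $M_{k,\mu}$ is the probability measure on $A^k$ (with the product $\sigma$-algebra $\mathcal{A}^k$) given by $$M_{k,\mu}(F)=\int_{\mathcal{M}_1(A)}Q^k(F)\,d\mu(Q),\quad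 F\in\mathcal{A}^k,$$ where $Q^k$ is the $k$-fold product measure of $Q$. The relative entropy between probability measures $P,Q$ on the same measurable space is $D(P\|Q)=\int \log\frac{dP}{dQ}\,dP$ if $P\ll Q$, and $D(P\|Q)=+\infty$ otherwise, where $\log$ is the natural logarithm. The mutual information of a pair of random variables $(X,Y)$ is $I(X;Y)=D(P_{X,Y}\|P_X\times P_Y)\in[0,+\infty]$. *)

(* Defs.v *)
From HB Require Import structures.
From mathcomp Require Import all_boot all_order all_algebra perm.
From mathcomp Require Import all_classical all_reals all_analysis.
From mathcomp Require Import measurable_realfun.

Set Implicit Arguments.
Unset Strict Implicit.
Unset Printing Implicit Defensive.

Import Order.TTheory GRing.Theory Num.Theory.

Local Open Scope classical_set_scope.
Local Open Scope ring_scope.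
Local Open Scope charge_scope.
Local Open Scope ereal_scope.

(* Completeness is stated with Cauchy filters; on a metric space this is the
   same as convergence of Cauchy sequences. The last clause says that the
   bijection f is an isomorphism of measurable spaces between T and the Borel
   sigma-algebra of S: both f and its inverse are measurable. *)
Definition standard_borel (R : realType) d (T : measurableType d) : Prop :=
  exists S : metricType R,
    [/\ forall F : set_system S, ProperFilter F -> cauchy F ->
          exists x : S, F --> x,
        exists2 D : set S, countable D & dense D &
        exists2 f : T -> S, bijective f &
          forall B : set S, <<s (@open S) >> B <-> measurable (f @^-1` B)].

Section relative_entropy.
Context d (T : measurableType d) (R : realType).

(* [lne 0 = -oo] only matters on a P-null set. *)
Definition relative_entropy (P Q : probability T R) : \bar R :=
  if `[< P `<< Q >]
  then \int[P]_x lne (('d (charge_of_finite_measure P) '/d Q) x)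
  else +oo.

End relative_entropy.

Section random_vectors.
Context d (Omega : measurableType d) (R : realType) (P : probability Omega R).

Section pair.
Context d1 (T1 : measurableType d1) d2 (T2 : measurableType d2).
Variables (X : {RV P >-> T1}) (Y : {RV P >-> T2}).

Definition rv_pair (w : Omega) : T1 * T2 := (X w, Y w).

Let measurable_rv_pair : measurable_fun [set: Omega] rv_pair.
Proof. exact/measurable_fun_pairP. Qed.

HB.instance Definition _ :=
  isMeasurableFun.Build _ _ _ _ rv_pair measurable_rv_pair.

Definition mutual_information : \bar R :=
  relative_entropy (distribution P rv_pair)
                   (distribution P X \x distribution P Y).

End pair.

Section tuple.
Context dA (A : measurableType dA).

Definition random_tuple m (X : 'I_m -> {RV P >-> A}) (w : Omega) : m.-tuple A :=
  [tuple X i w | i < m].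

Let measurable_random_tuple m (X : 'I_m -> {RV P >-> A}) :
  measurable_fun [set: Omega] (random_tuple X).
Proof.
apply/measurable_fun_tnthP => i.
rewrite (_ : _ \o _ = X i); first exact: measurable_funPT.
by apply/funext => w; rewrite /= tnth_mktuple.
Qed.

HB.instance Definition _ m (X : 'I_m -> {RV P >-> A}) :=
  isMeasurableFun.Build _ _ _ _ (random_tuple X) (@measurable_random_tuple m X).

(* Laws are compared on measurable sets only, because a [probability] is a
   function on all sets. *)
Definition exchangeable n (X : 'I_n -> {RV P >-> A}) : Prop :=
  forall (s : {perm 'I_n}) (B : set (n.-tuple A)), measurable B ->
    distribution P (random_tuple (fun i => X (s i))) B =
    distribution P (random_tuple X) B.

(* X_j, with j counted from 1; constant when j is not in {1, ..., n}. *)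
Definition component n (X : 'I_n -> {RV P >-> A}) (j : nat) : {RV P >-> A} :=
  if j is i.+1 then oapp X (cst point) (insub i) else cst point.

(* The block of length m starting at X_i (i counted from 1):
   (X_i, X_(i+1), ..., X_(i+m-1)). For m = 0 it is the constant empty tuple. *)
Definition block n (X : 'I_n -> {RV P >-> A}) (i m : nat)
    : {RV P >-> m.-tuple A} :=
  random_tuple (fun l : 'I_m => component X (i + l)%N).

End tuple.

End random_vectors.

Section power.
Context d (A : measurableType d) (R : realType).

Definition tuple_cons m (x : A * m.-tuple A) : m.+1.-tuple A :=
  [tuple of x.1 :: x.2].

Let measurable_tuple_cons m : measurable_fun [set: _] (@tuple_cons m).
Proof.
by apply: (measurable_cons (f := fst) (g := snd)).
Qed.

HB.instance Definition _ m :=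
  isMeasurableFun.Build _ _ _ _ (@tuple_cons m) (@measurable_tuple_cons m).

Fixpoint prob_power (Q : probability A R) (k : nat)
    : probability (k.-tuple A) R :=
  if k is m.+1 then distribution (Q \x prob_power Q m) (@tuple_cons m)
  else \d_[tuple].

Lemma prob_power_box (Q : probability A R) k (F : 'I_k -> set A) :
  (forall i, measurable (F i)) ->
  prob_power Q k [set t | forall i, F i (tnth t i)] = \prod_(i < k) Q (F i).
Proof.
elim: k F => [|k IHk] F mF.
  rewrite big_ord0 /= diracE mem_set//= => -[].
  by [].
rewrite big_ord_recl -(IHk (fun i => F (lift ord0 i)))//= /distribution /pushforward.
rewrite (_ : _ @^-1` _ = F ord0 `*`
    [set t | forall i, F (lift ord0 i) (tnth t i)]).
  rewrite product_measure1E//.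
  rewrite (_ : mkset _ = \bigcap_(i in [set: 'I_k])
      (@tnth k A ^~ i @^-1` F (lift ord0 i))).
    apply: fin_bigcap_measurable => [|i _]; first exact: finite_finset.
    by rewrite -[X in measurable X]setTI; exact: measurable_tnth.
  by apply/seteqP; split=> t /= Ft i => [_|]; exact: Ft.
apply/seteqP; split=> -[x t] /=.
  move=> Fxt; split; first exact: (Fxt ord0).
  by move=> i; have := Fxt (lift ord0 i); rewrite tnthS.
move=> [Fx Ft] i; case: (unliftP ord0 i) => [j ->|->//].
by rewrite tnthS.
Qed.

Lemma measurable_prob_power k :
  measurable_fun [set: pprobability A R]
    (fun Q => prob_power Q k : pprobability (k.-tuple A) R).
Proof.
elim: k => [|k IHk]; first exact: measurable_cst.
apply: (measurability
  (@pset _ _ _ : set (set (pprobability (k.+1.-tuple A) R)))) => //.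
move=> _ -[_ [r r01] [B mB <-] <-].
pose k1 := kprobability (@measurable_id _ (pprobability A R) setT).
have mk2 : measurable_fun [set: pprobability A R * A]
    (fun x => prob_power x.1 k : pprobability (k.-tuple A) R).
  exact: (measurableT_comp IHk).
pose k2 := kprobability mk2.
have mB' : measurable (@tuple_cons k @^-1` B).
  by rewrite -[_ @^-1` _]setTI; exact: measurable_tuple_cons.
have kE Q : prob_power Q k.+1 B = kproduct k1 k2 Q (@tuple_cons k @^-1` B).
  apply: eq_integral => x _ /=.
  rewrite /kernel.intker_indic integral_indic ?setIT ?xsectionE//.
  by rewrite -[X in measurable X]xsectionE; exact: measurable_xsection.
rewrite (_ : _ @^-1` _ =
    [set Q | kproduct k1 k2 Q (@tuple_cons k @^-1` B) < r%:E]).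
  by apply: emeasurable_fun_infty_o => //; exact: measurable_kproduct.
by apply/seteqP; split=> Q; rewrite /mset/= -kE.
Qed.

Variables (k : nat) (mu : probability (pprobability A R) R).

Definition mixture (F : set (k.-tuple A)) : \bar R :=
  \int[mu]_Q prob_power Q k F.

Let measurable_prob_power_ev F : measurable F ->
  measurable_fun [set: pprobability A R] (fun Q => prob_power Q k F).
Proof.
pose p := kprobability (@measurable_prob_power k).
exact: (@measurable_kernel _ _ _ _ _ p).
Qed.

Let mixture0 : mixture set0 = 0.
Proof. by rewrite /mixture integral0_eq. Qed.

Let mixture_ge0 F : 0 <= mixture F.
Proof. exact: integral_ge0. Qed.

Let mixture_sigma_additive : semi_sigma_additive mixture.
Proof.
move=> F mF tF mUF; rewrite [X in _ --> X](_ : _ =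
    \sum_(0 <= i <oo) mixture (F i)).
  by apply: is_cvg_nneseries => i _ _; exact: mixture_ge0.
rewrite -integral_nneseries//; last first.
  by move=> i; exact: measurable_prob_power_ev.
apply: eq_integral => Q _.
by rewrite measure_semi_bigcup.
Qed.

HB.instance Definition _ := isMeasure.Build _ _ _ mixture
  mixture0 mixture_ge0 mixture_sigma_additive.

Let mixture_setT : mixture [set: _] = 1.
Proof.
rewrite /mixture; under eq_integral do rewrite probability_setT.
by rewrite integral_cst// mul1e; exact: probability_setT.
Qed.

HB.instance Definition _ :=
  Measure_isProbability.Build _ _ _ mixture mixture_setT.

End power.

Arguments mixture {d A R} k mu F.

(* Main.v *)
Require Import Defs.
From HB Require Import structures.
From mathcomp Require Import all_boot all_order all_algebra perm.
From mathcomp Require Import all_classical all_reals all_analysis.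
From mathcomp Require Import measurable_realfun zify lra.

(* For disjoint index blocks U and V let r(U; V) be the density of the joint law
   of (X_U, X_V) with respect to the product of the marginals. If the right-hand
   side is finite, these densities exist for the blocks used below, and the chain
   rule is a telescoping sum: I(X_1^a; X_k^n) dominates the sum over j >= k of
   E log (r(X_1^a; X_j^n) / r(X_1^a; X_{j+1}^n)). Hence some j satisfies
   sum_{a < k} E log (r(X_1^a; X_j^n) / r(X_1^a; X_{j+1}^n)) <= RHS.
   Put Z = X_{j+1}^n. By exchangeability X_j may be replaced by any of
   X_1, ..., X_k, and the sum becomes E log (1 / G), where G is a product of k
   density ratios with E[F(X_1^k) G] <= E[int F(t) Q_Z^k(dt)] for F >= 0; here Q_Z
   is the conditional law of X_1 given Z, with density r(X_1; Z). Gibbs'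
   inequality then bounds the relative entropy of X_1^k with respect to the
   mixture of the Q_Z^k by E log (1 / G). When k = 1 the density r(X_1; Z) is not
   available, but the Dirac mass at the law of X_1 gives relative entropy 0. *)

Set Implicit Arguments.
Unset Strict Implicit.
Unset Printing Implicit Defensive.

Import Order.TTheory GRing.Theory Num.Theory.

Local Open Scope classical_set_scope.
Local Open Scope ring_scope.
Local Open Scope charge_scope.
Local Open Scope ereal_scope.


(** * Comparison and integrability of extended-real integrals *)

Section integral_lemmas.
Context d (T : measurableType d) (R : realType).

Lemma measurable_inv_ge0 (f : T -> R) : measurable_fun [set: T] f ->
  (forall x, (0 <= f x)%R) -> measurable_fun [set: T] (fun x => (f x)^-1)%R.
Proof.
(* On nonnegative reals inversion is the power with exponent -1; both send 0 to 0. *)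
move=> mf f0; rewrite (_ : (fun _ => _) = (fun x => f x `^ -1)%R).
  exact: (measurableT_comp (measurable_powR _)).
by apply/funext => x; rewrite powR_inv1.
Qed.

Lemma integral_probability1 (P : probability T R) : \int[P]_x 1 = 1.
Proof. rewrite integral_cst// mul1e; exact: probability_setT. Qed.

(** Positive and negative parts are compared separately; the extended difference of the two
    integrals is monotone even at infinite values. *)
Lemma ae_le_integral (mu : {measure set T -> \bar R})
    (f g : T -> \bar R) : measurable_fun [set: T] f ->
  measurable_fun [set: T] g -> {ae mu, forall x, f x <= g x} ->
  \int[mu]_x f x <= \int[mu]_x g x.
Proof.
move=> mf mg fg; rewrite integralE [leRHS]integralE; apply: leeB.
- apply: ae_ge0_le_integral => //; [exact: measurable_funepos..|].
  apply: filterS fg => x fgx _.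
  by rewrite !funeposE ge_max !le_max fgx lexx orbT.
- apply: ae_ge0_le_integral => //; [exact: measurable_funeneg..|].
  apply: filterS fg => x fgx _.
  by rewrite !funenegE ge_max !le_max leeN2 fgx lexx orbT.
Qed.

(** A finite difference of extended reals has two finite terms. This turns finiteness of an
    information into integrability of the log density. *)
Lemma integral_fin_num_integrable (mu : {measure set T -> \bar R})
    (f : T -> \bar R) : measurable_fun [set: T] f ->
  \int[mu]_x f x \is a fin_num -> mu.-integrable [set: T] f.
Proof.
move=> mf; rewrite integralE fin_numB => /andP[fp fn].
apply/integrableP; split => //.
rewrite (_ : (fun x => `|f x|) = f^\+ \+ f^\-); last exact: fune_abse.
rewrite ge0_integralD//; [|exact: measurable_funepos|exact: measurable_funeneg].
by rewrite ltey_eq fin_numD fp fn.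
Qed.

Lemma ae_eq_integrable (mu : {measure set T -> \bar R}) (f g : T -> \bar R) :
  measurable_fun [set: T] g -> ae_eq mu setT f g ->
  mu.-integrable [set: T] f -> mu.-integrable [set: T] g.
Proof.
move=> mg fg /integrableP[mf foo]; apply/integrableP; split => //.
rewrite (ae_eq_integral (fun x => `|f x|))//; first exact: measurableT_comp.
  exact: measurableT_comp.
by apply: filterS fg => x fgx Tx; rewrite fgx.
Qed.

(* Pointwise, [f <= (f + g) - g], [- f <= exp (- f)] and
   [- g <= exp (- g)]. *)
Lemma integrable_expR_sum (mu : {measure set T -> \bar R}) (f g : T -> R) :
  measurable_fun [set: T] f -> measurable_fun [set: T] g ->
  \int[mu]_x (expR (- f x))%:E < +oo -> \int[mu]_x (expR (- g x))%:E < +oo ->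
  mu.-integrable [set: T] (fun x => (f x + g x)%:E) ->
  mu.-integrable [set: T] (EFin \o f).
Proof.
move=> mf mg ef eg ifg.
have expint (h : T -> R) : measurable_fun [set: T] h ->
    \int[mu]_x (expR (- h x))%:E < +oo ->
    mu.-integrable [set: T] (EFin \o (fun x => expR (- h x))).
  move=> mh eh; apply/integrableP; split.
    apply/measurable_EFinP; apply: (measurableT_comp (@measurable_expR R)).
    exact: measurableT_comp.
  by under eq_integral do rewrite /= ger0_norm ?expR_ge0//.
apply: (@le_integrable _ _ _ mu _ _ (EFin \o f)
  (fun x => `|(f x + g x)%:E| + (expR (- f x))%:E + (expR (- g x))%:E)) => //.
- exact/measurable_EFinP.
- move=> x _ /=; rewrite lee_fin.
  have ? := expR_ge0 (- f x)%R; have ? := expR_ge0 (- g x)%R.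
  have ? : (- f x < expR (- f x))%R.
    have := expR_ge1Dx (- f x)%R; lra.
  have ? : (- g x < expR (- g x))%R.
    have := expR_ge1Dx (- g x)%R; lra.
  have ? := ler_norm (f x + g x)%R; have ? := normr_ge0 (f x + g x)%R.
  rewrite [leRHS]ger0_norm; last by rewrite !addr_ge0.
  by rewrite ler_norml; apply/andP; split; lra.
- apply: integrableD => //; last exact: expint.
  by apply: integrableD => //; [exact: integrable_abse|exact: expint].
Qed.

End integral_lemmas.

(** * Real-valued densities and relative entropy *)

Section radon_nikodym_real.
Context d (T : measurableType d) (R : realType).
Variables P Q : probability T R.

(** A version of dP/dQ that is finite and nonnegative everywhere when [P] is dominated by [Q], so
    that quotients and logarithms stay in [R]. *)
Definition rn_density (x : T) : R := fine (Radon_Nikodym_SigmaFinite.f P Q x).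

Hypothesis PQ : P `<< Q.

Lemma rn_densityE x : (rn_density x)%:E = Radon_Nikodym_SigmaFinite.f P Q x.
Proof. by rewrite fineK// Radon_Nikodym_SigmaFinite.f_fin_num. Qed.

Lemma rn_density_ge0 x : (0 <= rn_density x)%R.
Proof. exact/fine_ge0/Radon_Nikodym_SigmaFinite.f_ge0. Qed.

Lemma measurable_rn_density : measurable_fun [set: T] rn_density.
Proof.
apply: measurableT_comp => //.
exact: measurable_int (Radon_Nikodym_SigmaFinite.f_integrable _).
Qed.

Lemma integral_rn_density (f : T -> \bar R) :
  measurable_fun [set: T] f -> (forall x, 0 <= f x) ->
  \int[Q]_x (f x * (rn_density x)%:E) = \int[P]_x f x.
Proof.
move=> mf f0; rewrite -(Radon_Nikodym_SigmaFinite.change_of_variables PQ)//.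
by apply: eq_integral => x _; rewrite rn_densityE.
Qed.

(** The zero set of the density has [P]-mass equal to the [Q]-integral of the density over it, which
    is 0. *)
Lemma rn_density_gt0 : {ae P, forall x, (0 < rn_density x)%R}.
Proof.
have mE : measurable [set x | rn_density x = 0%R].
  have := measurable_rn_density measurableT (measurable_set1 0%R).
  by rewrite setTI.
suff PE : P [set x | rn_density x = 0%R] = 0.
  exists [set x | rn_density x = 0%R]; split => // x /= /negP.
  by rewrite -leNgt => r0; apply/eqP; rewrite eq_le r0 rn_density_ge0.
rewrite -[X in P X]setIT -integral_indic// -integral_rn_density.
- apply: integral0_eq => x _; rewrite indicE.
have [|_] := boolP (x \in _); last by rewrite mul0e.
by rewrite inE/= => ->; rewrite mule0.
- exact/measurable_EFinP.
- by move=> x; rewrite lee_fin.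
Qed.

(** Changing measure produces the factor r / r, which is 1 where r > 0 and 0 where r = 0; hence an
    inequality only. *)
Lemma integral_rn_density_inv (f : T -> \bar R) :
  measurable_fun [set: T] f -> (forall x, 0 <= f x) ->
  \int[P]_x (f x * ((rn_density x)^-1)%:E) <= \int[Q]_x f x.
Proof.
move=> mf f0.
have mi : measurable_fun [set: T] (fun x => ((rn_density x)^-1)%:E).
  apply/measurable_EFinP; apply: measurable_inv_ge0.
    exact: measurable_rn_density.
  exact: rn_density_ge0.
have i0 x : (0 <= (rn_density x)^-1)%R by rewrite invr_ge0 rn_density_ge0.
rewrite -integral_rn_density; last 2 first.
  exact: emeasurable_funM.
  by move=> x; rewrite mule_ge0// lee_fin.
have mr : measurable_fun [set: T] (fun x => (rn_density x)%:E).
  exact/measurable_EFinP/measurable_rn_density.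
apply: ge0_le_integral => //.
- move=> x _; apply: mule_ge0; last by rewrite lee_fin rn_density_ge0.
  by rewrite mule_ge0// lee_fin.
- by apply: emeasurable_funM => //; exact: emeasurable_funM.
- move=> x _; rewrite -muleA -EFinM -[leRHS]mule1; apply: lee_wpmul2l => //.
  rewrite lee_fin; have [->|r0] := eqVneq (rn_density x) 0%R.
    by rewrite mulr0 ler01.
  by rewrite mulVf.
Qed.

Lemma integral_rn_density1 : \int[Q]_x (rn_density x)%:E = 1.
Proof.
rewrite -(integral_probability1 P).
rewrite -(integral_rn_density (measurable_cst 1) (fun=> lee01)).
by apply: eq_integral => x _; rewrite mul1e.
Qed.

Lemma integral_rn_density_inv1 : \int[P]_x ((rn_density x)^-1)%:E <= 1.
Proof.
rewrite -(integral_probability1 Q).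
apply: le_trans (integral_rn_density_inv (measurable_cst 1) (fun=> lee01)).
by rewrite le_eqVlt; apply/orP; left; apply/eqP/eq_integral => x _; rewrite mul1e.
Qed.

(** The two versions of dP/dQ agree [Q]-a.e., hence [P]-a.e., and there the density is positive, so
    [lne] and [ln] coincide. *)
Lemma relative_entropyE :
  relative_entropy P Q = \int[P]_x (ln (rn_density x))%:E.
Proof.
rewrite /relative_entropy asboolT//.
pose D := 'd (charge_of_finite_measure P) '/d Q.
have mD : measurable_fun [set: T] D.
  exact: measurable_int (Radon_Nikodym_integrable _).
have lneD x : lne (D x) = if (fine (D x) <= 0)%R then -oo else (ln (fine (D x)))%:E.
  have Dx : D x = (fine (D x))%:E by rewrite fineK// Radon_Nikodym_fin_num.
  rewrite [in LHS]Dx; case: ifPn => [D0|]; first by rewrite le0_lneNy// lee_fin.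
  by rewrite -ltNge => D0; rewrite lne_EFin.
apply: ae_eq_integral => //.
- rewrite (_ : (fun _ => _) = fun x =>
      if (fine (D x) <= 0)%R then -oo else (ln (fine (D x)))%:E); last first.
    by apply/funext => x; exact: lneD.
  have mfD : measurable_fun [set: T] (fun x => fine (D x)) by exact: measurableT_comp.
  apply: measurable_fun_ifT => //.
    exact: measurable_fun_ler.
  by apply/measurable_EFinP; exact: measurableT_comp.
- apply/measurable_EFinP; apply: measurableT_comp => //.
  exact: measurable_rn_density.
- have fD : ae_eq P setT (Radon_Nikodym_SigmaFinite.f P Q) D.
    apply: (null_dominates_ae_eq _ PQ) => //.
    exact: ae_eq_Radon_Nikodym_SigmaFinite.
  apply: filterS2 fD rn_density_gt0 => x fD r0 _.
  by rewrite -/D -(fD I) -rn_densityE lne_EFin.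
Qed.

End radon_nikodym_real.

(** * Integrals and almost-sure statements under image laws *)

Section distribution_lemmas.
Context d d' (T : measurableType d) (T' : measurableType d') (R : realType).
Variables (P : probability T R) (X : {RV P >-> T'}).

Lemma measurable_integral_distribution (f : T' -> \bar R) :
  measurable_fun [set: T'] f ->
  \int[distribution P X]_y f y = \int[P]_x f (X x).
Proof.
move=> mf; rewrite integralE [RHS]integralE.
rewrite (ge0_integral_distribution X (measurable_funepos mf))//.
rewrite (ge0_integral_distribution X (measurable_funeneg mf))//.
by rewrite -funepos_comp -funeneg_comp.
Qed.

Lemma ae_distribution (U : T' -> Prop) :
  {ae distribution P X, forall y, U y} -> {ae P, forall x, U (X x)}.
Proof.
case=> N [mN PN sN]; exists (X @^-1` N); split => //.
  by rewrite -[X in measurable X]setTI; exact: measurable_funPT.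
by move=> x /= nU; exact: sN.
Qed.

End distribution_lemmas.

Section image_law.
Context d d' (T : measurableType d) (T' : measurableType d') (R : realType).
Variables (P : probability T R) (P' : probability T' R) (f : T -> T').
Hypothesis mf : measurable_fun [set: T] f.
Hypothesis P'E : forall B, measurable B -> P' B = P (f @^-1` B).

Lemma image_integral (g : T' -> \bar R) : measurable_fun [set: T'] g ->
  \int[P']_y g y = \int[P]_x g (f x).
Proof.
move=> mg; pose X : {RV P >-> T'} := HB.pack f (isMeasurableFun.Build _ _ _ _ f mf).
rewrite -[RHS](measurable_integral_distribution X mg).
by apply: eq_measure_integral => B mB _; exact: P'E.
Qed.

Lemma image_integrable (g : T' -> \bar R) : measurable_fun [set: T'] g ->
  P'.-integrable [set: T'] g <-> P.-integrable [set: T] (g \o f).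
Proof.
move=> mg.
have mgf : measurable_fun [set: T] (g \o f) by exact: measurableT_comp.
have E : \int[P']_y `|g y| = \int[P]_x `|(g \o f) x|.
  by rewrite image_integral//; exact: measurableT_comp.
by split=> /integrableP[_ ?]; apply/integrableP; split => //; rewrite ?E// -E.
Qed.

Lemma image_ae (U : T' -> Prop) :
  {ae P', forall y, U y} -> {ae P, forall x, U (f x)}.
Proof.
case=> N [mN PN sN]; exists (f @^-1` N); split => //.
- by rewrite -[X in measurable X]setTI; exact: mf.
- by rewrite -P'E.
- by move=> x /= nU; exact: sN.
Qed.

(** A null set upstairs has no measurable image in general; for positivity the exceptional set {g <=
    0} is itself measurable, and its preimage is null. *)
Lemma image_ae_gt0 (g : T' -> R) : measurable_fun [set: T'] g ->
  {ae P, forall x, (0 < g (f x))%R} -> {ae P', forall y, (0 < g y)%R}.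
Proof.
move=> mg [N [mN PN sN]].
have mG : measurable [set y | (g y <= 0)%R].
  have -> : [set y | (g y <= 0)%R] = setT `&` g @^-1` `]-oo, 0%R]%classic.
    by apply/seteqP; split => y /=; rewrite in_itv/=; [move=> gy|case].
  by apply: mg => //; exact: measurable_itv.
exists [set y | (g y <= 0)%R]; split => //.
- rewrite P'E//; apply/negligibleP.
    by rewrite -[X in measurable X]setTI; exact: mf.
  exists N; split => // x /= gx; apply: sN => /=.
  by rewrite ltNge gx.
- by move=> y /= /negP; rewrite -leNgt.
Qed.

End image_law.

(** * Gibbs' inequality, with a density and with a substitute for one *)

Section gibbs.
Context d (T : measurableType d) (R : realType).

Lemma ln_le_subr1 (x : R) : (0 < x -> ln x <= x - 1)%R.
Proof.
move=> x0; have -> : x = (1 + (x - 1))%R by rewrite addrC subrK.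
rewrite [leRHS]addrAC subrr add0r; apply: le_ln1Dx.
by rewrite ltrBrDr addNr.
Qed.

(** Integrate ln r >= 1 - 1/r under [P] and use that 1/r has [P]-integral at most 1. *)
Lemma relative_entropy_ge0 (P Q : probability T R) : 0 <= relative_entropy P Q.
Proof.
have [PQ|nPQ] := pselect (P `<< Q); last first.
  by rewrite /relative_entropy asboolF.
rewrite relative_entropyE//.
have mr := measurable_rn_density PQ.
have r0 := rn_density_ge0 PQ.
have mi : measurable_fun [set: T] (fun x => (rn_density P Q x)^-1)%R.
  exact: measurable_inv_ge0.
have i1 := integral_rn_density_inv1 PQ.
have ii : P.-integrable [set: T] (EFin \o (fun x => (rn_density P Q x)^-1)%R).
  apply/integrableP; split; first exact/measurable_EFinP.
  under eq_integral do rewrite /= ger0_norm ?invr_ge0//.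
  by rewrite (le_lt_trans i1)// ltry.
apply: (@le_trans _ _ (\int[P]_x ((cst 1%R x)%:E - ((rn_density P Q x)^-1)%:E))).
  rewrite integralB_EFin//; last exact: finite_measure_integrable_cst.
  by rewrite (integral_probability1 P) subre_ge0.
apply: ae_le_integral.
- by apply/measurable_EFinP; apply: measurable_funB.
- by apply/measurable_EFinP; apply: measurableT_comp.
- apply: filterS (rn_density_gt0 PQ) => x rx.
  have := @ln_le_subr1 (rn_density P Q x)^-1%R; rewrite invr_gt0 => /(_ rx).
  by rewrite lnV ?posrE// -EFinB lee_fin /=; lra.
Qed.

End gibbs.

Section relative_entropy_le.
Context d d' (T : measurableType d) (T' : measurableType d') (R : realType).
Variables (P : probability T R) (X : {RV P >-> T'}) (Q : probability T' R).
Variable g : T -> R.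
Hypothesis mg : measurable_fun [set: T] g.
Hypothesis g0 : forall x, (0 <= g x)%R.
Hypothesis g_gt0 : {ae P, forall x, (0 < g x)%R}.
Hypothesis gQ : forall f, measurable_fun [set: T'] f -> (forall y, 0 <= f y) ->
  \int[P]_x (f (X x) * (g x)%:E) <= \int[Q]_y f y.

(** Test [gQ] on the indicator of a [Q]-null set: the integrand vanishes a.e., and since g > 0 a.e.
    the indicator must vanish. *)
Let PXQ : distribution P X `<< Q.
Proof.
apply/null_content_dominatesP => B mB QB.
have mXB : measurable (X @^-1` B).
  by rewrite -[X in measurable X]setTI; exact: measurable_funPT.
have mf : measurable_fun [set: T'] (fun y => (\1_B y)%:E : \bar R).
  exact/measurable_EFinP.
have mfg : measurable_fun [set: T] (fun x => (\1_B (X x))%:E * (g x)%:E).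
  apply: emeasurable_funM; first exact: (measurableT_comp mf).
  exact/measurable_EFinP.
have f0 y : 0 <= (\1_B y)%:E :> \bar R by rewrite lee_fin.
have : \int[P]_x `|(\1_B (X x))%:E * (g x)%:E| = 0.
  apply/eqP; rewrite eq_le integral_ge0// andbT.
  under eq_integral do rewrite gee0_abs ?mule_ge0 ?lee_fin//.
  by rewrite (le_trans (gQ mf f0))// integral_indic// setIT QB.
move/(ae_eq_integral_abs P measurableT mfg) => fg0.
rewrite /distribution /pushforward -[X in P X]setIT -integral_indic//.
rewrite (@ae_eq_integral _ _ _ _ _ (cst 0))//.
- by rewrite integral0.
- exact/measurable_EFinP.
apply: filterS2 fg0 g_gt0 => x fgx gx _.
have /eqP := fgx I; rewrite mule_eq0 => /orP[/eqP//|].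
by rewrite eqe gt_eqF.
Qed.

(** Here g plays the role of the inverse density. With r the density of the law of X with respect to
    [Q], [gQ] at f = r gives E[r(X) g] <= 1. Integrating ln r(X) <= r(X) g - 1 - ln g then bounds
    the entropy. *)
Lemma relative_entropy_le : P.-integrable [set: T] (EFin \o (fun x => ln (g x))) ->
  relative_entropy (distribution P X) Q <= - \int[P]_x (ln (g x))%:E.
Proof.
move=> ig.
rewrite relative_entropyE//.
pose r := rn_density (distribution P X) Q.
have mr : measurable_fun [set: T'] r by exact: measurable_rn_density.
have r0 : forall x, (0 <= r x)%R by exact: rn_density_ge0.
have mrX : measurable_fun [set: T] (fun x => r (X x)) by exact: measurableT_comp.
rewrite measurable_integral_distribution; last first.
  by apply/measurable_EFinP; apply: measurableT_comp.
have rg1 : \int[P]_x (r (X x) * g x)%:E <= 1.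
  have mrE : measurable_fun [set: T'] (EFin \o r) by exact/measurable_EFinP.
  apply: (le_trans (gQ mrE _)) => [y|]; first by rewrite lee_fin.
  by rewrite integral_rn_density1.
have irg : P.-integrable [set: T] (EFin \o (fun x => r (X x) * g x)%R).
  apply/integrableP; split; first exact/measurable_EFinP/measurable_funM.
  under eq_integral do rewrite /= ger0_norm ?mulr_ge0//.
  by rewrite (le_lt_trans rg1)// ltry.
have i1 : P.-integrable [set: T] (EFin \o cst 1%R).
  exact: finite_measure_integrable_cst.
apply: (@le_trans _ _ (\int[P]_x
    (((r (X x) * g x)%:E - 1%:E) - (ln (g x))%:E))).
  apply: ae_le_integral.
  - by apply/measurable_EFinP; apply: measurableT_comp.
  - apply/measurable_EFinP; apply: measurable_funB; last exact: measurableT_comp.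
    by apply: measurable_funB => //; apply: measurable_funM.
  - have := ae_distribution (rn_density_gt0 PXQ).
    apply: filterS2 g_gt0 => x gx rx.
    rewrite -!EFinB lee_fin lerBrDr -lnM ?posrE//.
    by apply: ln_le_subr1; rewrite mulr_gt0.
rewrite integralB//; last exact: (integrableB _ irg i1).
rewrite integralB_EFin// (integral_probability1 P).
by rewrite -[leRHS]add0e leeB// leeBlDr// add0e.
Qed.

End relative_entropy_le.

(** * Disintegration of a law dominated by a product *)

Section density_kernel.
Context d1 d2 (T1 : measurableType d1) (T2 : measurableType d2) (R : realType).
Variables (alpha : probability T1 R) (r : T1 * T2 -> R).
Hypothesis mr : measurable_fun [set: T1 * T2] r.
Hypothesis r0 : forall x, (0 <= r x)%R.

(** The unnormalised conditional law given z. The proofs are arguments of the term so that measure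
    and kernel structures can be inferred from it. *)
Definition section_density of measurable_fun [set: T1 * T2] r
    & (forall x, (0 <= r x)%R) := fun (z : T2) (B : set T1) =>
  \int[alpha]_(x in B) (r (x, z))%:E.

Local Notation k := (section_density mr r0).

Let measurable_r z : measurable_fun [set: T1] (fun x => (r (x, z))%:E).
Proof.
apply/measurable_EFinP; apply: (measurableT_comp mr).
exact: pair2_measurable.
Qed.

Let k0 z : k z set0 = 0.
Proof. by rewrite /section_density integral_set0. Qed.

Let k_ge0 z B : 0 <= k z B.
Proof. by apply: integral_ge0 => x _; rewrite lee_fin. Qed.

Let k_sigma_additive z : semi_sigma_additive (k z).
Proof.
move=> F mF tF mUF; rewrite /section_density ge0_integral_bigcup//.
- by apply: is_cvg_nneseries => i _ _; exact: k_ge0.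
- exact: measurable_funTS.
- by move=> x _; rewrite lee_fin.
Qed.

HB.instance Definition _ z := isMeasure.Build _ _ _ (k z)
  (k0 z) (k_ge0 z) (@k_sigma_additive z).

Definition density_kernel : T2 -> {measure set T1 -> \bar R} := k.

Let measurable_k B : measurable B ->
  measurable_fun [set: T2] (fun z => k z B).
Proof.
move=> mB; rewrite (_ : (fun _ => _) =
    (fun z => \int[alpha]_x ((\1_B x * r (x, z))%:E))).
  apply: (measurable_fun_fubini_tonelli_G
    (fun u : T1 * T2 => (\1_B u.1 * r u)%:E)) => /=.
  - apply/measurable_EFinP; apply: measurable_funM => //.
    apply: (measurableT_comp _ measurable_fst); exact: measurable_indic.
  - by move=> x; rewrite lee_fin mulr_ge0.
apply/funext => z; rewrite /section_density integral_mkcond.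
apply: eq_integral => x _; rewrite patchE indicE.
by case: ifPn; rewrite ?mul1r ?mul0r.
Qed.

HB.instance Definition _ := isKernel.Build _ _ _ _ R
  density_kernel measurable_k.

End density_kernel.

Section disintegration.
Context d1 d2 (T1 : measurableType d1) (T2 : measurableType d2) (R : realType).
Variables (alpha : probability T1 R) (beta : probability T2 R).

(** By uniqueness of densities, r agrees [alpha]-a.e. with the Radon-Nikodym density, for which the
    change of variables is known. *)
Lemma integral_density (nu : probability T1 R) (r : T1 -> R) :
  measurable_fun [set: T1] r -> (forall x, (0 <= r x)%R) ->
  (forall B, measurable B -> nu B = \int[alpha]_(x in B) (r x)%:E) ->
  forall f : T1 -> \bar R, measurable_fun [set: T1] f -> (forall x, 0 <= f x) ->
  \int[nu]_x f x = \int[alpha]_x (f x * (r x)%:E).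
Proof.
move=> mr r0 nuE f mf f0.
have nua : nu `<< alpha.
  apply/null_content_dominatesP => B mB aB.
  rewrite nuE//; apply: null_set_integral => //.
  exact: measurable_funTS (measurableT_comp _ mr).
rewrite -(integral_rn_density nua)//; apply: ae_eq_integral => //.
- by apply: emeasurable_funM => //; apply/measurable_EFinP/measurable_rn_density.
- by apply: emeasurable_funM => //; exact/measurable_EFinP.
apply: ae_eqe_mul2l.
rewrite (_ : (fun x => _) = Radon_Nikodym_SigmaFinite.f nu alpha); last first.
  by apply/funext => x; rewrite rn_densityE.
apply: integral_ae_eq => //.
- exact: Radon_Nikodym_SigmaFinite.f_integrable.
- exact/measurable_EFinP.
- by move=> E _ mE; rewrite -nuE// -Radon_Nikodym_SigmaFinite.f_integral.
Qed.

(** The sections r(., z) of the joint density define measures k z. Since the second marginal is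
    [beta], the mass of k z integrates to beta C over every measurable C, so it is 1 for
    [beta]-almost every z. *)
Lemma disintegration (lam : probability (T1 * T2)%type R) :
  lam `<< (alpha \x beta) ->
  (forall C, measurable C -> lam (setT `*` C) = beta C) ->
  exists2 Q : T2 -> pprobability T1 R, measurable_fun [set: T2] Q &
  forall f : T1 * T2 -> \bar R, measurable_fun [set: T1 * T2] f ->
    (forall x, 0 <= f x) ->
  \int[lam]_u f u = \int[beta]_z \int[Q z]_x f (x, z).
Proof.
move=> ll lb.
pose r := rn_density lam (alpha \x beta).
have mr : measurable_fun [set: T1 * T2] r by exact: measurable_rn_density.
have r0 : forall u, (0 <= r u)%R by exact: rn_density_ge0.
pose k := density_kernel alpha mr r0 : R.-ker T2 ~> T1.
have lamE f : measurable_fun [set: T1 * T2] f -> (forall u, 0 <= f u) ->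
    \int[lam]_u f u = \int[beta]_z \int[alpha]_x (f (x, z) * (r (x, z))%:E).
  move=> mf f0; rewrite -(integral_rn_density ll)//.
  rewrite (fubini_tonelli2 (fun u => f u * (r u)%:E))//.
  - by apply: emeasurable_funM => //; exact/measurable_EFinP.
  - by move=> u; rewrite mule_ge0// lee_fin.
have mk : measurable_fun [set: T2] (fun z => k z setT) by exact: measurable_kernel.
have kC C : measurable C -> \int[beta]_(z in C) k z setT = beta C.
  move=> mC.
  have mf : measurable_fun [set: T1 * T2] (fun u => (\1_C u.2)%:E : \bar R).
    apply/measurable_EFinP; apply: (measurableT_comp _ measurable_snd).
    exact: measurable_indic.
  rewrite -lb// -[X in lam X]setIT -integral_indic//; last exact: measurableX.
  rewrite (@eq_integral _ _ _ lam _ (fun u => (\1_C u.2)%:E)); last first.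
    by move=> u _; rewrite !indicE; congr ((_ : bool)%:R%:E); apply/idP/idP;
      rewrite !inE /= => // -[].
  rewrite lamE//.
  rewrite integral_mkcond; apply: eq_integral => z _; rewrite patchE /k/=.
  rewrite indicE; case: ifPn => _ /=.
    by apply: eq_integral => x _; rewrite mul1e.
  by rewrite integral0_eq// => x _; rewrite mul0e.
have k1 : ae_eq beta setT (fun z => k z setT) (cst 1).
  apply: integral_ae_eq => //.
  - apply/integrableP; split => //.
    under eq_integral do rewrite gee0_abs//.
    by rewrite kC// probability_setT ltry.
  - by move=> C _ mC; rewrite kC// integral_cst// mul1e.
(* Normalising yields a probability for every z; [point] is the default where the mass is 0 or
   infinite. *)
have mQ : measurable_fun [set: T2]
    (fun z => mnormalize (k z) point : pprobability T1 R).
  exact: measurable_fun_mnormalize.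
exists (fun z => mnormalize (k z) point : pprobability T1 R) => //.
move=> f mf f0; rewrite lamE//.
have mfr : measurable_fun [set: T1 * T2] (fun u => f u * (r u)%:E).
  by apply: emeasurable_funM => //; exact/measurable_EFinP.
apply: ae_eq_integral => //.
- apply: (measurable_fun_fubini_tonelli_G (fun u => f u * (r u)%:E)) => //.
  by move=> u; rewrite mule_ge0// lee_fin.
- apply: (measurable_fun_integral_finite_kernel (fun u : T2 * T1 => f (u.2, u.1))
    (kprobability mQ)) => //.
  apply: (measurableT_comp mf).
  exact: measurable_fun_pair.
(* Where the mass is 1, normalisation leaves k z unchanged, and r(., z) is its density. *)
apply: filterS k1 => z kz _.
have mp : measurable_fun [set: T1] (fun x : T1 => (x, z)) by exact: pair2_measurable.
apply/esym/(@integral_density _ (fun x => r (x, z))) => //.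
- exact: (measurableT_comp mr).
- move=> B mB /=; rewrite /mnormalize.
  by rewrite (kz I) /= onee_eq0 /= invr1 mule1.
- exact: (measurableT_comp mf).
Qed.

End disintegration.

(** * Integration against powers and mixtures *)

Section mixture_integral.
Context d (A : measurableType d) (R : realType).

Lemma integral_prob_powerS (Q : probability A R) k (f : k.+1.-tuple A -> \bar R) :
  measurable_fun [set: k.+1.-tuple A] f -> (forall t, 0 <= f t) ->
  \int[prob_power Q k.+1]_t f t =
  \int[prob_power Q k]_t \int[Q]_x f (tuple_cons (x, t)).
Proof.
move=> mf f0; rewrite /= ge0_integral_distribution//.
rewrite (fubini_tonelli2 (f \o @tuple_cons _ A k))//.
- exact: (measurableT_comp mf (measurable_funPT (@tuple_cons _ A k))).
- by move=> u; exact: f0.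
Qed.

Lemma measurable_integral_prob_power k (f : k.-tuple A -> \bar R) :
  measurable_fun [set: k.-tuple A] f -> (forall t, 0 <= f t) ->
  measurable_fun [set: pprobability A R] (fun Q => \int[prob_power Q k]_t f t).
Proof.
move=> mf f0.
apply: (measurable_fun_integral_finite_kernel
  (fun u : pprobability A R * k.-tuple A => f u.2)
  (kprobability (@measurable_prob_power _ A R k))) => //.
exact: (measurableT_comp mf).
Qed.

Lemma integral_mixture k (mu : probability (pprobability A R) R)
    (f : k.-tuple A -> \bar R) :
  measurable_fun [set: k.-tuple A] f -> (forall t, 0 <= f t) ->
  \int[mixture k mu]_t f t = \int[mu]_Q \int[prob_power Q k]_t f t.
Proof.
move=> mf f0.
(* The mixture is the composite of the constant kernel [mu] with the kernel Q -> Q^k, evaluated at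
   an arbitrary point of [A]. *)
pose l := kprobability (@measurable_cst _ _ A
  (pprobability (pprobability A R) R) setT mu).
have mp : measurable_fun [set: A * pprobability A R]
    (fun u => prob_power u.2 k : pprobability (k.-tuple A) R).
  exact: (measurableT_comp (@measurable_prob_power _ A R k)).
have := @integral_kcomp _ _ _ _ _ _ _ l (kprobability mp) point _ f0 mf.
move=> /= <-; apply: eq_measure_integral => B mB _.
by [].
Qed.

Lemma integral_mixture_distribution k d' (T : measurableType d')
    (beta : probability T R) (Q : {RV beta >-> pprobability A R})
    (f : k.-tuple A -> \bar R) :
  measurable_fun [set: k.-tuple A] f -> (forall t, 0 <= f t) ->
  \int[mixture k (distribution beta Q)]_t f t =
  \int[beta]_z \int[prob_power (Q z) k]_t f t.
Proof.
move=> mf f0; rewrite integral_mixture// ge0_integral_distribution//.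
- exact: measurable_integral_prob_power.
- by move=> q; exact: integral_ge0.
Qed.

End mixture_integral.

(** * Maps that forget or move one coordinate between two blocks *)

Section tuple_maps.
Context d (A : measurableType d).

Definition tuple_behead m (v : m.+1.-tuple A) : m.-tuple A := [tuple of behead v].

Lemma measurable_tuple_behead m : measurable_fun [set: _] (@tuple_behead m).
Proof. exact: measurable_behead. Qed.

Definition tuple_head m (v : m.+1.-tuple A) : A := thead v.

Lemma measurable_tuple_head m : measurable_fun [set: _] (@tuple_head m).
Proof. exact: measurable_tnth. Qed.

Lemma tuple_cons_behead m x (t : m.-tuple A) :
  tuple_behead (tuple_cons (x, t)) = t.
Proof. exact/val_inj. Qed.

Lemma tuple_cons_eta m (v : m.+1.-tuple A) :
  tuple_cons (tuple_head v, tuple_behead v) = v.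
Proof. by apply: val_inj => /=; rewrite [in RHS](tuple_eta v). Qed.

Lemma tnth_tuple_cons0 m x (t : m.-tuple A) : tnth (tuple_cons (x, t)) ord0 = x.
Proof. by []. Qed.

Lemma tnth_tuple_consS m x (t : m.-tuple A) i :
  tnth (tuple_cons (x, t)) (lift ord0 i) = tnth t i.
Proof. by rewrite /tuple_cons tnthS. Qed.

(** Sends (X_1^a, X_j^n) to (X_1^a, X_{j+1}^n). *)
Definition drop_head a m (u : a.-tuple A * m.+1.-tuple A) :
  a.-tuple A * m.-tuple A := (u.1, tuple_behead u.2).

Lemma measurable_drop_head a m : measurable_fun [set: _] (@drop_head a m).
Proof.
apply: measurable_fun_pair => //.
exact: (measurableT_comp (@measurable_tuple_behead m)).
Qed.

(** Sends (X_1^a, X_j^n) to ((X_j, X_1^a), X_{j+1}^n); under exchangeability the image has the law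
    of (X_1^{a+1}, X_{j+1}^n). *)
Definition shift_head a m (u : a.-tuple A * m.+1.-tuple A) :
  a.+1.-tuple A * m.-tuple A :=
  (tuple_cons (tuple_head u.2, u.1), tuple_behead u.2).

Lemma measurable_shift_head a m : measurable_fun [set: _] (@shift_head a m).
Proof.
apply: measurable_fun_pair.
  apply: (measurableT_comp (measurable_funPT (@tuple_cons _ A a))) => //.
  apply: measurable_fun_pair => //.
  exact: (measurableT_comp (@measurable_tuple_head m)).
exact: (measurableT_comp (@measurable_tuple_behead m)).
Qed.

Definition unshift_head a m (u : a.+1.-tuple A * m.-tuple A) :
  a.-tuple A * m.+1.-tuple A :=
  (tuple_behead u.1, tuple_cons (tuple_head u.1, u.2)).

Lemma measurable_unshift_head a m : measurable_fun [set: _] (@unshift_head a m).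
Proof.
apply: measurable_fun_pair.
  exact: (measurableT_comp (@measurable_tuple_behead a)).
apply: (measurableT_comp (measurable_funPT (@tuple_cons _ A m))) => //.
apply: measurable_fun_pair => //.
exact: (measurableT_comp (@measurable_tuple_head a)).
Qed.

Lemma shift_headK a m : cancel (@shift_head a m) (@unshift_head a m).
Proof.
by case=> u v; rewrite /unshift_head /shift_head/= tuple_cons_behead tuple_cons_eta.
Qed.

End tuple_maps.

(** * Products of image laws as images of product laws *)

Section product_distribution.
Context d1 d2 d1' d2' (T1 : measurableType d1) (T2 : measurableType d2)
  (T1' : measurableType d1') (T2' : measurableType d2') (R : realType).
Variables (al : probability T1 R) (be : probability T2 R).
Variables (al' : probability T1' R) (be' : probability T2' R).
Variables (f1 : T1 -> T1') (f2 : T2 -> T2').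
Hypotheses (mf1 : measurable_fun [set: T1] f1).
Hypotheses (mf2 : measurable_fun [set: T2] f2).
Hypothesis alE : forall B, measurable B -> al' B = al (f1 @^-1` B).
Hypothesis beE : forall B, measurable B -> be' B = be (f2 @^-1` B).

Let measurable_prod_map :
  measurable_fun [set: T1 * T2] (fun u => (f1 u.1, f2 u.2)).
Proof.
apply: measurable_fun_pair; first exact: (measurableT_comp mf1).
exact: (measurableT_comp mf2).
Qed.

Lemma integral_product_image (g : T1' * T2' -> \bar R) :
  measurable_fun [set: T1' * T2'] g -> (forall u, 0 <= g u) ->
  \int[al' \x be']_u g u = \int[al \x be]_u g (f1 u.1, f2 u.2).
Proof.
move=> mg g0.
have mgf : measurable_fun [set: T1 * T2] (fun u => g (f1 u.1, f2 u.2)).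
  exact: (measurableT_comp mg).
rewrite !fubini_tonelli1// /fubini_F.
rewrite (image_integral mf1 alE); last exact: measurable_fun_fubini_tonelli_F.
apply: eq_integral => x _ /=.
by rewrite (image_integral mf2 beE)//; exact: (measurableT_comp mg (pair1_measurable _)).
Qed.

Lemma product_imageE B : measurable B ->
  (al' \x be') B = (al \x be) ((fun u => (f1 u.1, f2 u.2)) @^-1` B).
Proof.
move=> mB.
have mpB : measurable ((fun u => (f1 u.1, f2 u.2)) @^-1` B).
  by rewrite -[X in measurable X]setTI; exact: measurable_prod_map.
have m1 : measurable_fun [set: T1' * T2'] (EFin \o \1_B : _ -> \bar R).
  exact/measurable_EFinP.
have := integral_product_image m1; rewrite /= integral_indic// setIT => ->.
  by rewrite [LHS]integral_indic// setIT.
by move=> u; rewrite lee_fin.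
Qed.

End product_distribution.

(** * The entropy bound for an abstract family of block laws *)

Section exchangeable_family.
Context d (A : measurableType d) (R : realType).
(* Below, [lam a m], [al a] and [be m] are the laws of (X_1^a, X_{n-m+1}^n), X_1^a
   and X_{n-m+1}^n, and M = n - k + 1. Exchangeability enters through [lam_shift]
   only: X_{n-m} is moved in front of X_1^a. *)
Variables (lam : forall a m, probability (a.-tuple A * m.-tuple A)%type R).
Variables (al : forall a, probability (a.-tuple A) R).
Variables (be : forall m, probability (m.-tuple A) R).
Variables k M : nat.
Hypothesis k_gt0 : (0 < k)%N.
Hypothesis lam_drop : forall a m, (a < k)%N -> (m < M)%N ->
  forall B, measurable B -> lam a m B = lam a m.+1 (@drop_head _ A a m @^-1` B).
Hypothesis lam_shift : forall a m, (a < k)%N -> (m < M)%N ->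
  forall B, measurable B ->
  lam a.+1 m B = lam a m.+1 (@shift_head _ A a m @^-1` B).
Hypothesis be_drop : forall m, (m < M)%N -> forall B, measurable B ->
  be m B = be m.+1 (@tuple_behead _ A m @^-1` B).
Hypothesis lam_be : forall a m, (a < k)%N -> (m <= M)%N ->
  forall B, measurable B -> be m B = lam a m (snd @^-1` B).
Hypothesis lam_ac : forall a m, (a < k)%N -> (m <= M)%N ->
  lam a m `<< (al a \x be m).

Let r a m := rn_density (lam a m) (al a \x be m).
Arguments r : clear implicits.

Let r0 a m : (a < k)%N -> (m <= M)%N -> forall u, (0 <= r a m u)%R.
Proof. by move=> ak mM; exact/rn_density_ge0/lam_ac. Qed.

Let mr a m : (a < k)%N -> (m <= M)%N -> measurable_fun [set: _] (r a m).
Proof. by move=> ak mM; exact/measurable_rn_density/lam_ac. Qed.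

Let mrdrop a m : (a < k)%N -> (m < M)%N ->
  measurable_fun [set: _] (fun u => r a m (@drop_head _ A a m u)).
Proof.
move=> ak mM; apply: (measurableT_comp (mr ak (ltnW mM))).
exact: measurable_drop_head.
Qed.

(* The conditional law has density [r 1 m] with respect to [al 1]: this is where
   [1 < k] is needed. *)
Lemma exists_conditional_law m : (1 < k)%N -> (m < M)%N ->
  exists2 Q : m.-tuple A -> pprobability A R, measurable_fun [set: _] Q &
  forall f : m.+1.-tuple A -> \bar R, measurable_fun [set: _] f ->
    (forall v, 0 <= f v) ->
  \int[be m.+1]_v f v = \int[be m]_z \int[Q z]_x f (tuple_cons (x, z)).
Proof.
move=> k1 mM.
pose h (u : 1.-tuple A * m.-tuple A) : A * m.-tuple A := (tuple_head u.1, u.2).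
have mh : measurable_fun [set: _] h.
  apply: measurable_fun_pair => //.
  exact: (measurableT_comp (@measurable_tuple_head _ A 0)).
pose H : {RV lam 1 m >-> (A * m.-tuple A)%type} :=
  HB.pack h (isMeasurableFun.Build _ _ _ _ h mh).
pose hd : {RV al 1 >-> A} := HB.pack (@tuple_head _ A 0)
  (isMeasurableFun.Build _ _ _ _ (@tuple_head _ A 0) (@measurable_tuple_head _ A 0)).
have [||Q mQ QE] := @disintegration _ _ _ _ _ (distribution (al 1) hd) (be m)
    (distribution (lam 1 m) H).
- apply/null_content_dominatesP => B mB B0.
  have /null_content_dominatesP := lam_ac k1 (ltnW mM); apply.
    by rewrite -[X in measurable X]setTI; exact: (mh measurableT B mB).
  rewrite -[RHS]B0; apply/esym/(@product_imageE _ _ _ _ _ _ _ _ _ (al 1) (be m)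
    (distribution (al 1) hd) (be m) (@tuple_head _ A 0) id) => //.
  exact: measurable_tuple_head.
- move=> C mC; rewrite (lam_be k1 (ltnW mM))//.
  rewrite /distribution /pushforward; congr (lam 1 m _).
  by apply/seteqP; split => // u [].
exists Q => // f mf f0.
have mfc : measurable_fun [set: A * m.-tuple A] (f \o @tuple_cons _ A m).
  exact: (measurableT_comp mf (measurable_funPT (@tuple_cons _ A m))).
have k0 : (0 < k)%N by exact: ltn_trans k1.
rewrite -(QE (f \o @tuple_cons _ A m))//; last by move=> u; exact: f0.
rewrite (measurable_integral_distribution H mfc).
(* At a = 0 the shift turns X_{n-m}^n into (X_{n-m}, X_{n-m+1}^n), so this pair has the law
   [lam 1 m] of (X_1, X_{n-m+1}^n). *)
rewrite (image_integral (@measurable_shift_head _ A 0 m) (lam_shift k0 mM)); last first.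
  exact: (measurableT_comp mfc mh).
rewrite (image_integral measurable_snd (lam_be k0 mM))//.
by apply: eq_integral => u _; rewrite /= /h/= tuple_cons_eta.
Qed.

(** With j = n - m this is r(X_1^a; X_{j+1}^n) / r(X_1^a; X_j^n), the inverse of the ratio in the
    chain rule; its expected logarithm is minus an increment of information. *)
Let ratio a m u : R := (r a m (drop_head u) / r a m.+1 u)%R.
Arguments ratio : clear implicits.

Let ratio_ge0 a m : (a < k)%N -> (m < M)%N -> forall u, (0 <= ratio a m u)%R.
Proof.
by move=> ak mM u; rewrite /ratio divr_ge0//; apply: r0 => //; exact: ltnW.
Qed.

Let measurable_ratio a m : (a < k)%N -> (m < M)%N ->
  measurable_fun [set: _] (ratio a m).
Proof.
move=> ak mM; apply: measurable_funM; first exact: mrdrop.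
by apply: measurable_inv_ge0; [exact: mr|exact: r0].
Qed.

(** The denominator of [ratio] cancels the density of [lam a m.+1], leaving the product law. *)
Let le_integral_ratio a m (f : a.-tuple A * m.+1.-tuple A -> \bar R) :
  (a < k)%N -> (m < M)%N -> measurable_fun [set: _] f -> (forall u, 0 <= f u) ->
  \int[lam a m.+1]_u (f u * (ratio a m u)%:E) <=
  \int[al a \x be m.+1]_u (f u * (r a m (drop_head u))%:E).
Proof.
move=> ak mM mf f0.
under eq_integral do rewrite /ratio EFinM muleA.
apply: (integral_rn_density_inv (lam_ac ak mM)).
- by apply: emeasurable_funM => //; apply/measurable_EFinP; exact: mrdrop.
- by move=> u; rewrite mule_ge0// lee_fin; apply: r0 => //; exact: ltnW.
Qed.

Let integral_ratio_le1 a m : (a < k)%N -> (m < M)%N ->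
  \int[lam a m.+1]_u (ratio a m u)%:E <= 1.
Proof.
move=> ak mM; under eq_integral do rewrite -[_%:E]mul1e.
apply: le_trans (le_integral_ratio ak mM (measurable_cst 1) (fun=> lee01)) _.
under eq_integral do rewrite mul1e.
rewrite -(integral_rn_density1 (lam_ac ak (ltnW mM))).
rewrite (@integral_product_image _ _ _ _ _ _ _ _ _ (al a) (be m.+1) _ _ id
  (@tuple_behead _ A m))//.
- exact: measurable_tuple_behead.
- exact: be_drop.
- by apply/measurable_EFinP; apply: mr => //; exact: ltnW.
- by move=> u; rewrite lee_fin; apply: r0 => //; exact: ltnW.
Qed.

(* The product of density ratios called G at the top of the file. *)
Fixpoint chain m a : a.-tuple A * m.-tuple A -> R :=
  match a with
  | 0 => fun=> 1%R
  | b.+1 => fun u =>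
    (chain (tuple_behead u.1, u.2) * ratio b m (unshift_head u))%R
  end.

Let chain_shift m a u :
  chain (shift_head u) = (@chain m a (drop_head u) * ratio a m u)%R.
Proof. by rewrite /= shift_headK tuple_cons_behead. Qed.

Let chain_ge0 m a : (a <= k)%N -> (m < M)%N -> forall u, (0 <= @chain m a u)%R.
Proof.
move=> + mM; elim: a => [_ u|a IHa ak u] /=; first exact: ler01.
by rewrite mulr_ge0 ?ratio_ge0// IHa// ltnW.
Qed.

Let measurable_chain m a : (a <= k)%N -> (m < M)%N ->
  measurable_fun [set: _] (@chain m a).
Proof.
move=> + mM; elim: a => [_|a IHa ak] /=; first exact: measurable_cst.
apply: measurable_funM.
  apply: (measurableT_comp (IHa (ltnW ak))).
  apply: measurable_fun_pair => //.
  exact: (measurableT_comp (@measurable_tuple_behead _ A a)).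
exact: (measurableT_comp (measurable_ratio ak mM) (@measurable_unshift_head _ A a m)).
Qed.

Let ratio_gt0 a m : (a < k)%N -> (m < M)%N ->
  {ae lam a m.+1, forall u, (0 < r a m (@drop_head _ A a m u))%R /\
    (0 < r a m.+1 u)%R}.
Proof.
move=> ak mM; have mmM := ltnW mM.
have := image_ae (@measurable_drop_head _ A a m) (lam_drop ak mM)
  (rn_density_gt0 (lam_ac ak mmM)).
by apply: filterS2 (rn_density_gt0 (lam_ac ak mM)) => u r1 r2; split.
Qed.

Let chain_gt0 m a : (a <= k)%N -> (m < M)%N ->
  {ae lam a m, forall u, (0 < @chain m a u)%R}.
Proof.
move=> + mM; elim: a => [_|a IHa ak]; first by apply: aeW => u /=; exact: ltr01.
apply: (image_ae_gt0 (@measurable_shift_head _ A a m) (lam_shift ak mM)).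
  exact: measurable_chain.
have := image_ae (@measurable_drop_head _ A a m) (lam_drop ak mM) (IHa (ltnW ak)).
apply: filterS2 (ratio_gt0 ak mM) => u [r1 r2] c0.
by rewrite chain_shift mulr_gt0// divr_gt0.
Qed.

(** Induction on a. The last factor of [chain] trades [lam a m.+1] for a product law, under which
    the moved coordinate can be integrated against Q_z; its numerator [r a m] then restores
    [lam a m], where the induction hypothesis applies. *)
Lemma integral_chain_le m (Q : m.-tuple A -> pprobability A R) :
  (m < M)%N -> measurable_fun [set: _] Q ->
  (forall f : m.+1.-tuple A -> \bar R, measurable_fun [set: _] f ->
    (forall v, 0 <= f v) ->
    \int[be m.+1]_v f v = \int[be m]_z \int[Q z]_x f (tuple_cons (x, z))) ->
  forall a, (a <= k)%N -> forall F : a.-tuple A * m.-tuple A -> \bar R,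
  measurable_fun [set: _] F -> (forall u, 0 <= F u) ->
  \int[lam a m]_u (F u * (chain u)%:E) <=
  \int[be m]_z \int[prob_power (Q z) a]_t F (t, z).
Proof.
move=> mM mQ QE; elim=> [_ F mF F0|a IHa ak F mF F0].
  have mF0 : measurable_fun [set: m.-tuple A] (fun z => F ([tuple], z)).
    exact: (measurableT_comp mF (pair1_measurable _)).
  rewrite (@eq_integral _ _ _ _ _ (fun u => F ([tuple], u.2))); last first.
    by move=> [u z] _; rewrite /= mule1 (tuple0 u).
  rewrite -(image_integral measurable_snd (lam_be k_gt0 (ltnW mM)) mF0).
  rewrite le_eqVlt; apply/orP; left; apply/eqP.
  apply: eq_integral => z _; rewrite integral_dirac// ?diracT ?mul1e//.
  exact: (measurableT_comp mF (pair2_measurable _)).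
(* [F] with its first coordinate averaged under Q_z: the function given to the induction
   hypothesis. *)
pose F' (u : a.-tuple A * m.-tuple A) := \int[Q u.2]_x F (tuple_cons (x, u.1), u.2).
have mFc : measurable_fun [set: (a.-tuple A * m.-tuple A) * A]
    (fun w => F (tuple_cons (w.2, w.1.1), w.1.2)).
  apply: (measurableT_comp mF); apply: measurable_fun_pair.
    apply: (measurableT_comp (measurable_funPT (@tuple_cons _ A a))) => //.
    by apply: measurable_fun_pair => //; exact: (measurableT_comp measurable_fst).
  exact: (measurableT_comp measurable_snd).
have F'0 u : 0 <= F' u by exact: integral_ge0.
have mF' : measurable_fun [set: _] F'.
  have mQ2 : measurable_fun [set: a.-tuple A * m.-tuple A] (fun u => Q u.2).
    exact: (measurableT_comp mQ).
  apply: (measurable_fun_integral_finite_kernel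
    (fun w => F (tuple_cons (w.2, w.1.1), w.1.2)) (kprobability mQ2)) => //.
have mmM := ltnW mM; have aak := ltnW ak.
have mchE := measurable_chain aak mM.
have mch1 : measurable_fun [set: _] (fun u => (@chain m a.+1 u)%:E).
  by apply/measurable_EFinP; exact: measurable_chain.
rewrite (image_integral (@measurable_shift_head _ A a m) (lam_shift ak mM)); last first.
  exact: emeasurable_funM.
(* The remaining weight is a function of [drop_head u], hence constant in the coordinate being
   averaged. *)
pose K (u : a.-tuple A * m.-tuple A) := (chain u * r a m u)%R.
have mK : measurable_fun [set: _] (fun u => (K u)%:E).
  by apply/measurable_EFinP; apply: measurable_funM => //; exact: mr.
have K0 u : (0 <= K u)%R by rewrite mulr_ge0 ?r0 ?chain_ge0.
have mFs : measurable_fun [set: _] (fun u => F (@shift_head _ A a m u)).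
  exact: (measurableT_comp mF (@measurable_shift_head _ A a m)).
have mKd : measurable_fun [set: _] (fun u => (K (@drop_head _ A a m u))%:E).
  exact: (measurableT_comp mK (@measurable_drop_head _ A a m)).
under eq_integral do rewrite chain_shift EFinM muleA.
apply: (le_trans (le_integral_ratio ak mM _ _)).
- apply: emeasurable_funM => //; apply/measurable_EFinP.
  exact: (measurableT_comp mchE (@measurable_drop_head _ A a m)).
- by move=> u; rewrite mule_ge0// lee_fin chain_ge0.
under eq_integral do rewrite -muleA -EFinM -/(K _).
rewrite fubini_tonelli1//; last 2 first.
- exact: emeasurable_funM.
- by move=> u; rewrite mule_ge0// lee_fin.
rewrite /fubini_F.
have E u : \int[be m.+1]_v (F (shift_head (u, v)) * (K (drop_head (u, v)))%:E) =
    \int[be m]_z (F' (u, z) * (K (u, z))%:E).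
  rewrite QE; last 2 first.
  - by apply: (measurableT_comp (emeasurable_funM mFs mKd)); exact: pair1_measurable.
  - by move=> v; rewrite mule_ge0// lee_fin.
  apply: eq_integral => z _.
  under eq_integral do rewrite /shift_head /drop_head/= tuple_cons_behead.
  rewrite ge0_integralZr// ?lee_fin//.
  exact: (measurableT_comp mFc (pair1_measurable (u, z))).
under eq_integral do rewrite E.
rewrite -(fubini_tonelli1 (fun u => F' u * (K u)%:E))//; last 2 first.
- exact: emeasurable_funM.
- by move=> u; rewrite mule_ge0// lee_fin.
under eq_integral do rewrite /K EFinM muleA.
(* The factor [r a m] is absorbed, turning the product law back into [lam a m]. *)
rewrite (integral_rn_density (lam_ac ak mmM)); last 2 first.
- by apply: emeasurable_funM => //; exact/measurable_EFinP.
- by move=> u; rewrite mule_ge0// lee_fin chain_ge0.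
apply: (le_trans (IHa aak F' mF' F'0)).
rewrite le_eqVlt; apply/orP; left; apply/eqP.
apply: eq_integral => z _.
rewrite integral_prob_powerS//.
exact: (measurableT_comp mF (pair2_measurable _)).
Qed.

Let info a m := relative_entropy (lam a m) (al a \x be m).
Arguments info : clear implicits.

Let infoE a m : (a < k)%N -> (m <= M)%N ->
  info a m = \int[lam a m]_u (ln (r a m u))%:E.
Proof. by move=> ak mM; rewrite /info relative_entropyE//; exact: lam_ac. Qed.

Hypothesis info_fin : forall a, (a < k)%N -> info a M \is a fin_num.

Let measurable_lnr a m : (a < k)%N -> (m <= M)%N ->
  measurable_fun [set: _] (fun u => ln (r a m u)).
Proof. by move=> ak mM; apply: measurableT_comp => //; exact: mr. Qed.

Let measurable_lnr_drop a m : (a < k)%N -> (m < M)%N ->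
  measurable_fun [set: _] (fun u => ln (r a m (@drop_head _ A a m u))).
Proof.
by move=> ak mM; apply: measurableT_comp => //; exact: mrdrop.
Qed.

(** Write ln r(X_1^a; X_j^n) as the log density of the shorter block plus -ln [ratio]. The
    exponentials of minus these terms are an inverse density and [ratio], both of integral at most
    1, so each term is integrable. *)
Let integrable_lnr_drop a m : (a < k)%N -> (m < M)%N ->
  (lam a m.+1).-integrable [set: _] (EFin \o (fun u => ln (r a m.+1 u))) ->
  (lam a m.+1).-integrable [set: _]
    (EFin \o (fun u => ln (r a m (@drop_head _ A a m u)))).
Proof.
move=> ak mM ilnr; have mmM := ltnW mM.
apply: (integrable_expR_sum
  (g := fun u => (ln (r a m.+1 u) - ln (r a m (drop_head u)))%R)).
- exact: measurable_lnr_drop.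
- apply: measurable_funB; first exact: measurable_lnr.
  exact: measurable_lnr_drop.
- rewrite -(image_integral (g := fun u => (expR (- ln (r a m u)))%:E)
    (@measurable_drop_head _ A a m) (lam_drop ak mM)); last first.
    apply/measurable_EFinP; apply: (measurableT_comp (@measurable_expR R)).
    by apply: measurableT_comp => //; exact: measurable_lnr.
  rewrite (@ae_eq_integral _ _ _ _ _ (fun u => ((r a m u)^-1)%:E))//.
  + exact: le_lt_trans (integral_rn_density_inv1 (lam_ac ak mmM)) (ltry _).
  + apply/measurable_EFinP; apply: (measurableT_comp (@measurable_expR R)).
    by apply: measurableT_comp => //; exact: measurable_lnr.
  + apply/measurable_EFinP; apply: measurable_inv_ge0; first exact: mr.
    exact: r0.
  + apply: filterS (rn_density_gt0 (lam_ac ak mmM)) => u ru _.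
    by rewrite expRN lnK// posrE.
- rewrite (@ae_eq_integral _ _ _ _ _ (fun u => (ratio a m u)%:E))//.
  + exact: le_lt_trans (integral_ratio_le1 ak mM) (ltry _).
  + apply/measurable_EFinP; apply: (measurableT_comp (@measurable_expR R)).
    apply: measurableT_comp => //; apply: measurable_funB.
      exact: measurable_lnr.
    exact: measurable_lnr_drop.
  + by apply/measurable_EFinP; exact: measurable_ratio.
  + apply: filterS (ratio_gt0 ak mM) => u [r1 r2] _.
    by rewrite opprB expRB !lnK// posrE.
- rewrite (_ : (fun _ => _) = EFin \o (fun u => ln (r a m.+1 u)))//.
  by apply/funext => u /=; rewrite addrC subrK.
Qed.

Let integrable_lnr a m : (a < k)%N -> (m <= M)%N ->
  (lam a m).-integrable [set: _] (EFin \o (fun u => ln (r a m u))).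
Proof.
(* Descending induction from m = M, where [info_fin] gives integrability. *)
move=> ak mM; rewrite -(subKn mM); have := leq_subr m M.
elim: (M - m)%N => [_|j IHj jM].
  rewrite subn0; apply: integral_fin_num_integrable.
    by apply/measurable_EFinP; exact: measurable_lnr.
  by have := info_fin ak; rewrite infoE.
have jE : (M - j = (M - j.+1).+1)%N by rewrite subnSK.
have mM' : (M - j.+1 < M)%N by rewrite -jE leq_subr.
apply/(image_integrable (@measurable_drop_head _ A a (M - j.+1))
  (lam_drop ak mM')).
  by apply/measurable_EFinP; apply: measurable_lnr => //; exact: ltnW.
apply: integrable_lnr_drop => //.
by rewrite -jE; exact: IHj (ltnW jM).
Qed.

Let info_fin_num a m : (a < k)%N -> (m <= M)%N -> info a m \is a fin_num.
Proof.
by move=> ak mM; rewrite infoE//; apply: integrable_fin_num => //; exact: integrable_lnr.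
Qed.

Let ln_ratio_ae a m : (a < k)%N -> (m < M)%N ->
  ae_eq (lam a m.+1) setT (fun u => (ln (ratio a m u))%:E)
    (fun u => (ln (r a m (drop_head u)))%:E - (ln (r a m.+1 u))%:E).
Proof.
move=> ak mM; apply: filterS (ratio_gt0 ak mM) => u [r1 r2] _.
by rewrite /ratio ln_div ?posrE// EFinB.
Qed.

Let integrable_ln_ratio a m : (a < k)%N -> (m < M)%N ->
  (lam a m.+1).-integrable [set: _] (EFin \o (fun u => ln (ratio a m u))).
Proof.
move=> ak mM.
have i1 := integrable_lnr ak mM.
have i2 := integrable_lnr_drop ak mM i1.
have mln : measurable_fun [set: _] (fun u => (ln (ratio a m u))%:E).
  apply/measurable_EFinP; apply: measurableT_comp => //.
  exact: measurable_ratio.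
apply: (ae_eq_integrable _ (ae_eq_sym (ln_ratio_ae ak mM))) => //.
exact: integrableB.
Qed.

Let integral_ln_ratio a m : (a < k)%N -> (m < M)%N ->
  \int[lam a m.+1]_u (ln (ratio a m u))%:E =
  (fine (info a m) - fine (info a m.+1))%:E.
Proof.
move=> ak mM; have mmM := ltnW mM.
have i1 := integrable_lnr ak mM.
have i2 := integrable_lnr_drop ak mM i1.
rewrite (ae_eq_integral _ _ _ _ _ (ln_ratio_ae ak mM))//.
- rewrite integralB_EFin// EFinB !fineK ?info_fin_num// !infoE//; congr (_ - _).
  rewrite (image_integral (@measurable_drop_head _ A a m) (lam_drop ak mM))//.
  by apply/measurable_EFinP; exact: measurable_lnr.
- exact: measurable_int (integrable_ln_ratio ak mM).
- exact: measurable_int (integrableB measurableT i2 i1).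
Qed.

Let measurable_lnchain a m : (a <= k)%N -> (m < M)%N ->
  measurable_fun [set: _] (fun u => (ln (@chain m a u))%:E).
Proof.
move=> ak mM; apply/measurable_EFinP; apply: measurableT_comp => //.
exact: measurable_chain.
Qed.

(** Each shift splits the logarithm into a shorter chain, evaluated through [lam_drop], and one ln
    [ratio], evaluated under [lam a m.+1]. *)
Let integral_ln_chain m a : (a <= k)%N -> (m < M)%N ->
  (lam a m).-integrable [set: _] (EFin \o (fun u => ln (@chain m a u))) /\
  \int[lam a m]_u (ln (@chain m a u))%:E =
  (\sum_(b < a) (fine (info b m) - fine (info b m.+1)))%:E.
Proof.
move=> + mM; elim: a => [_|a IHa ak].
  rewrite big_ord0; split.
    rewrite (_ : _ \o _ = cst 0) //; first exact: integrable0.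
    by apply/funext => u /=; rewrite ln1.
  by apply: integral0_eq => u _ /=; rewrite ln1.
have [ich ichE] := IHa (ltnW ak).
have mch := measurable_lnchain (ltnW ak) mM.
have mchs := measurable_lnchain ak mM.
have ir := integrable_ln_ratio ak mM.
have idr : (lam a m.+1).-integrable [set: _]
    (EFin \o (fun u => ln (chain (@drop_head _ A a m u)))).
  exact: (image_integrable (@measurable_drop_head _ A a m) (lam_drop ak mM) mch).1 ich.
have E : ae_eq (lam a m.+1) setT
    (fun u => (ln (@chain m a.+1 (@shift_head _ A a m u)))%:E)
    (fun u => (ln (chain (@drop_head _ A a m u)))%:E + (ln (ratio a m u))%:E).
  have := image_ae (@measurable_drop_head _ A a m) (lam_drop ak mM)
    (chain_gt0 (ltnW ak) mM).
  apply: filterS2 (ratio_gt0 ak mM) => u [r1 r2] c0 _.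
  by rewrite chain_shift lnM ?posrE ?divr_gt0.
have mEl : measurable_fun [set: _]
    (fun u => (ln (@chain m a.+1 (@shift_head _ A a m u)))%:E).
  exact: (measurableT_comp mchs (@measurable_shift_head _ A a m)).
have mEr := measurable_int _ (integrableD measurableT idr ir).
split.
  apply/(image_integrable (@measurable_shift_head _ A a m) (lam_shift ak mM) mchs).
  apply: (ae_eq_integrable _ (ae_eq_sym E)) => //.
  exact: integrableD.
rewrite (image_integral (@measurable_shift_head _ A a m) (lam_shift ak mM) mchs).
rewrite (ae_eq_integral _ _ _ _ _ E)// integralD// integral_ln_ratio//.
rewrite big_ord_recr /= [in RHS]EFinD -ichE; congr (_ + _).
by rewrite (image_integral (@measurable_drop_head _ A a m) (lam_drop ak mM)).
Qed.

(** Averaging: the M increments telescope to at most the sum of the [info b M], the terms [info b 0]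
    being nonnegative, so not all of them can exceed the average. *)
Let exists_small_increment : (0 < M)%N -> exists2 m, (m < M)%N &
  (\sum_(b < k) (fine (info b m.+1) - fine (info b m)) <=
   M%:R^-1 * \sum_(b < k) fine (info b M))%R.
Proof.
move=> M0; have [/existsP[m mP]|] := boolP [exists m : 'I_M,
    (\sum_(b < k) (fine (info b m.+1) - fine (info b m)) <=
     M%:R^-1 * \sum_(b < k) fine (info b M))%R].
  by exists m.
rewrite negb_exists => /forallP noM; exfalso.
set S := (\sum_(b < k) fine (info b M))%R in noM.
have : (\sum_(m < M) (M%:R^-1 * S) <
    \sum_(m < M) \sum_(b < k) (fine (info b m.+1) - fine (info b m)))%R.
  apply: ltr_sum; last by move=> m _; rewrite ltNge.
  by apply/hasP; exists (Ordinal M0) => //; rewrite mem_index_enum.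
rewrite sumr_const card_ord -[X in (X < _)%R]mulr_natl mulrA mulfV ?mul1r; last first.
  by rewrite pnatr_eq0 -lt0n.
rewrite exchange_big/= ltNge => /negP; apply.
apply: ler_sum => b _.
rewrite -(big_mkord xpredT (fun m => fine (info b m.+1) - fine (info b m))%R).
rewrite telescope_sumr// lerBlDr lerDl.
exact/fine_ge0/relative_entropy_ge0.
Qed.

(** Quantifying over pairs (X, Z) with joint law [lam k m] makes the bound speak of
    [distribution P X] itself. *)
Lemma exists_mixture : (1 < k)%N -> (0 < M)%N ->
  exists2 m, (m < M)%N & exists mu : probability (pprobability A R) R,
  forall d' (T : measurableType d') (P : probability T R)
    (X : {RV P >-> k.-tuple A}) (Z : T -> m.-tuple A),
  measurable_fun [set: T] Z ->
  (forall B, measurable B ->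
    lam k m B = P ((fun w => (X w, Z w)) @^-1` B)) ->
  relative_entropy (distribution P X) (mixture k mu) <=
  M%:R^-1%:E * \sum_(a < k) relative_entropy (lam a M) (al a \x be M).
Proof.
move=> k1 M0; have [m mM mle] := exists_small_increment M0.
exists m => //; have [Q mQ QE] := exists_conditional_law k1 mM.
pose q : {RV be m >-> pprobability A R} :=
  HB.pack Q (isMeasurableFun.Build _ _ _ _ Q mQ).
(* The mixing measure is the law of the random conditional law Q_Z. *)
exists (distribution (be m) q) => d' T P X Z mZ lamE.
have mXZ : measurable_fun [set: T] (fun w => (X w, Z w)).
  exact: measurable_fun_pair.
have mc := measurable_chain (leqnn k) mM.
have mlc := measurable_lnchain (leqnn k) mM.
have [ic icE] := integral_ln_chain (leqnn k) mM.
have gQ f : measurable_fun [set: k.-tuple A] f -> (forall y, 0 <= f y) ->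
    \int[P]_w (f (X w) * (@chain m k (X w, Z w))%:E) <=
    \int[mixture k (distribution (be m) q)]_y f y.
  move=> mf f0; rewrite integral_mixture_distribution//.
  have mf1 : measurable_fun [set: k.-tuple A * m.-tuple A] (f \o fst).
    exact: measurableT_comp.
  have := integral_chain_le mM mQ QE (leqnn k) mf1 (fun u => f0 u.1).
  rewrite (image_integral mXZ lamE)//.
  by apply: emeasurable_funM => //; exact/measurable_EFinP.
(* Gibbs' inequality with [chain] at (X, Z) as the substitute for the inverse density. *)
apply: le_trans (relative_entropy_le _ _ _ gQ _) _.
- exact: (measurableT_comp mc mXZ).
- by move=> w; exact: chain_ge0.
- exact: (image_ae mXZ lamE (chain_gt0 (leqnn k) mM)).
- exact: (image_integrable mXZ lamE mlc).1 ic.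
rewrite -(image_integral mXZ lamE mlc) icE.
have -> : \sum_(a < k) relative_entropy (lam a M) (al a \x be M) =
    (\sum_(a < k) fine (info a M))%:E.
  by rewrite -sumEFin; apply: eq_bigr => a _; rewrite fineK ?info_fin_num.
rewrite -EFinN -EFinM lee_fin; apply: le_trans mle.
rewrite -sumrN; apply: ler_sum => b _.
by rewrite opprB.
Qed.

End exchangeable_family.

(** * Block laws of an exchangeable vector of length n + 1 *)

Lemma eq_from_tnth_cons (T : Type) m (t1 t2 : m.+1.-tuple T) :
  tnth t1 ord0 = tnth t2 ord0 ->
  (forall j : 'I_m, tnth t1 (lift ord0 j) = tnth t2 (lift ord0 j)) -> t1 = t2.
Proof.
move=> e0 eS; apply: eq_from_tnth => i.
by case: (unliftP ord0 i) => [j|] ->.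
Qed.

Section exchangeable_laws.
Context (R : realType) (dA : measure_display) (A : measurableType dA).
Context (d : measure_display) (Omega : measurableType d).
Variables (P : probability Omega R) (n : nat).
Variable X : 'I_n.+1 -> {RV P >-> A}.

Lemma component_inord j : (0 < j <= n.+1)%N -> component X j = X (inord j.-1).
Proof.
case: j => // j /=; rewrite ltnS => jn.
by rewrite (insubT (fun i => i < n.+1)%N jn)/=; congr X; apply: val_inj; rewrite /= inordK.
Qed.

(** Blocks are indexed from 1, so the final m of n + 1 entries start at n + 1 - m + 1. *)
Definition last_block m := block X (n.+1 - m).+1 m.

Definition block_law a m : probability (a.-tuple A * m.-tuple A)%type R :=
  distribution P (rv_pair (block X 1 a) (last_block m)).

Lemma tuple_behead_last_block m w : (m < n.+1)%N ->
  tuple_behead (last_block m.+1 w) = last_block m w.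
Proof.
move=> mn; apply: eq_from_tnth => l.
rewrite tnth_behead !tnth_mktuple; congr (component X _ w).
rewrite inordK; last by rewrite ltnS; exact: ltn_ord l.
by rewrite addnS -addSn; congr (_ + _)%N; lia.
Qed.

Lemma tuple_head_last_block m w : (m < n.+1)%N ->
  tuple_head (last_block m.+1 w) = X (inord (n - m)) w.
Proof.
move=> mn; rewrite /tuple_head /thead tnth_mktuple addn0 component_inord; last by lia.
by congr (X _ w); congr inord; rewrite /=; lia.
Qed.

Lemma block_law_drop a m B : (m < n.+1)%N ->
  block_law a m B = block_law a m.+1 (@drop_head _ A a m @^-1` B).
Proof.
move=> mn; rewrite /block_law /distribution /pushforward; congr (P _).
by apply/seteqP; split => w; rewrite /= /rv_pair /drop_head /= tuple_behead_last_block.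
Qed.

(** A cycle on zero-based positions: entry c comes first, entries 0 to c - 1 move one place back,
    later entries stay. *)
Definition to_front (c : nat) (i : 'I_n.+1) : 'I_n.+1 :=
  inord (if (i == 0 :> nat)%N then c else if (i <= c)%N then i.-1 else i).

Lemma to_front_inj c : (c < n.+1)%N -> injective (to_front c).
Proof.
move=> cn i j /(congr1 val) /=; have ? := ltn_ord i; have ? := ltn_ord j.
rewrite !inordK; [move=> e; apply: val_inj => /=; move: e|..];
  by repeat case: ifP => ?; lia.
Qed.

(** Apply exchangeability to the cycle that brings the head of [last_block m.+1] to the front. As a
    <= n - m, the first a entries are shifted by one and the last m are fixed. *)
Lemma block_law_shift a m B : exchangeable X -> (a + m < n.+1)%N ->
  measurable B ->
  block_law a.+1 m B = block_law a m.+1 (@shift_head _ A a m @^-1` B).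
Proof.
move=> hX amn mB.
(* Zero-based position of the head of [last_block m.+1]. *)
have cn : (n - m < n.+1)%N by lia.
pose s := perm (to_front_inj cn).
pose phi (x : n.+1.-tuple A) : a.+1.-tuple A * m.-tuple A :=
  ([tuple tnth x (inord i) | i < a.+1],
   [tuple tnth x (inord (n.+1 - m + l)) | l < m]).
have mphi : measurable_fun [set: _] phi.
  apply: measurable_fun_pair; apply/measurable_fun_tnthP => i.
    rewrite (_ : _ \o _ = fun x : n.+1.-tuple A => tnth x (inord i)).
      exact: measurable_tnth.
    by apply/funext => x; rewrite /= tnth_mktuple.
  rewrite (_ : _ \o _ =
      fun x : n.+1.-tuple A => tnth x (inord (n.+1 - m + i)%N)).
    exact: measurable_tnth.
  by apply/funext => x; rewrite /= tnth_mktuple.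
have mphiB : measurable (phi @^-1` B).
  by rewrite -[X in measurable X]setTI; exact: mphi.
have := hX s _ mphiB; rewrite /distribution /pushforward /block_law.
rewrite /distribution /pushforward.
move=> /esym; congr (_ = _); congr (P _); apply/funext => w; congr (B _).
- congr (_, _); apply: eq_from_tnth => i; rewrite !tnth_mktuple.
  + rewrite component_inord; last by have := ltn_ord i; lia.
    by [].
  + rewrite component_inord; last by have := ltn_ord i; lia.
    by congr (X _ w); congr inord; lia.
- rewrite /shift_head; congr (_, _).
    apply: eq_from_tnth_cons => [|j].
      rewrite !tnth_mktuple permE /to_front.
      rewrite [RHS]tnth_tuple_cons0 tuple_head_last_block; last by lia.
      by rewrite inordK.
    rewrite [LHS]tnth_mktuple [LHS]tnth_mktuple permE /to_front.
    have ja := ltn_ord j.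
    rewrite [RHS]tnth_tuple_consS [RHS]tnth_mktuple component_inord; last by lia.
    congr (X _ w); congr inord.
    rewrite lift0 inordK; last by lia.
    by rewrite /=; case: ifP => ?; lia.
  apply: eq_from_tnth => i.
  rewrite tuple_behead_last_block; last by lia.
  have im := ltn_ord i.
  rewrite !tnth_mktuple permE /to_front component_inord; last by lia.
  congr (X _ w); congr inord; rewrite inordK; last by lia.
  by case: ifP => ?; [lia|case: ifP => ?; lia].
Qed.

End exchangeable_laws.

(** * Absolute continuity and information of blocks; the case k = 1 *)

Section block_information.
Context (R : realType) (dA : measure_display) (A : measurableType dA).
Context (d : measure_display) (Omega : measurableType d).
Variables (P : probability Omega R) (n : nat).
Variable X : 'I_n.+1 -> {RV P >-> A}.

(** Dropping a coordinate maps both the joint law and the product of marginals to those of the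
    shorter block, so null sets pull back; descend from M to m. *)
Lemma block_law_dominates a M m : (M <= n.+1)%N -> (m <= M)%N ->
  block_law X a M `<< distribution P (block X 1 a) \x distribution P (last_block X M) ->
  block_law X a m `<< distribution P (block X 1 a) \x distribution P (last_block X m).
Proof.
move=> Mn mM; rewrite -(subKn mM); have := leq_subr m M.
elim: (M - m)%N => [|j IHj jM ac]; first by rewrite subn0.
have {}ac := IHj (ltnW jM) ac.
have jE : (M - j = (M - j.+1).+1)%N by rewrite subnSK.
rewrite {}jE in ac; set m' := (M - j.+1)%N in ac *.
have m'n : (m' < n.+1)%N by rewrite /m'; lia.
apply/null_content_dominatesP => B mB B0.
rewrite block_law_drop//.
have mdB : measurable (@drop_head _ A a m' @^-1` B).
  by rewrite -[X in measurable X]setTI; exact: measurable_drop_head.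
move/null_content_dominatesP : ac; apply => //; rewrite -[RHS]B0.
apply/esym/(@product_imageE _ _ _ _ _ _ _ _ _ (distribution P (block X 1 a))
  (distribution P (last_block X m'.+1)) (distribution P (block X 1 a))
  (distribution P (last_block X m')) id (@tuple_behead _ A m')) => //.
  exact: measurable_tuple_behead.
move=> C mC; rewrite /distribution /pushforward; congr (P _).
by apply/seteqP; split => w; rewrite /= tuple_behead_last_block.
Qed.

Lemma relative_entropy_fin_dominates d' (T : measurableType d')
    (Q1 Q2 : probability T R) :
  relative_entropy Q1 Q2 \is a fin_num -> Q1 `<< Q2.
Proof.
by rewrite /relative_entropy; case: asboolP.
Qed.

(** The block from position k to the end is the last block of length n + 1 - k + 1; the sum is
    reindexed by a = i - 1. *)
Lemma sum_mutual_informationE k : (0 < k <= n)%N ->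
  \sum_(1 <= i < k.+1)
    mutual_information (block X 1 (i - 1)) (block X k (n.+1 - k + 1)) =
  \sum_(a < k) relative_entropy (block_law X a (n.+1 - k + 1))
    (distribution P (block X 1 a) \x
     distribution P (last_block X (n.+1 - k + 1))).
Proof.
move=> kn; rewrite big_add1/= big_mkord; apply: eq_bigr => i _.
rewrite subn1/= /block_law /last_block /mutual_information.
by have -> : ((n.+1 - (n.+1 - k + 1)).+1 = k)%N by lia.
Qed.

Lemma exists_mixture1 : exists mu : probability (pprobability A R) R,
  relative_entropy (distribution P (block X 1 1)) (mixture 1 mu) <= 0.
Proof.
pose Q : pprobability A R := distribution P (component X 1).
(* Writing 0 as -E ln 1 allows Gibbs' inequality with g = 1, for which [gQ] holds with equality. *)
exists (\d_Q); rewrite (_ : 0 = - \int[P]_w (ln (cst 1%R w))%:E); last first.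
  by rewrite integral0_eq ?oppe0// => w _; rewrite ln1.
apply: relative_entropy_le => //.
- by exists set0; split => // w /=; rewrite ltr01.
- move=> f mf f0; rewrite integral_mixture//.
  rewrite integral_dirac//; last exact: measurable_integral_prob_power.
  rewrite diracT mul1e integral_prob_powerS//.
  have mfc : measurable_fun [set: A] (fun x => f (tuple_cons (x, [tuple]))).
    apply: (measurableT_comp mf); apply: (measurableT_comp (measurable_funPT (@tuple_cons _ A 0))).
    exact: pair2_measurable.
  rewrite integral_dirac//; last first.
    apply: (measurable_fun_fubini_tonelli_G (f \o @tuple_cons _ A 0)).
      exact: (measurableT_comp mf (measurable_funPT (@tuple_cons _ A 0))).
    by move=> u; exact: f0.
  rewrite diracT mul1e measurable_integral_distribution//.
  rewrite le_eqVlt; apply/orP; left; apply/eqP; apply: eq_integral => w _.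
  rewrite mule1; congr f; apply: eq_from_tnth => i.
  by rewrite tnth_mktuple !ord1.
- rewrite (_ : _ \o _ = cst 0) //; first exact: integrable0.
  by apply/funext => u /=; rewrite ln1.
Qed.

End block_information.

(** * Reduction to the abstract family: infinite bound, k = 1, and k > 1 *)

Theorem theorem2p1 (R : realType)
  (dA : measure_display) (A : measurableType dA)
  (hA : standard_borel R A)
  (d : measure_display) (Omega : measurableType d) (P : probability Omega R)
  (n : nat) (X : 'I_n -> {RV P >-> A}) (hX : exchangeable X)
  (k : nat) (hk : (1 <= k <= n - 1)%N) :
  exists mu : probability (pprobability A R) R,
    relative_entropy (distribution P (block X 1 k)) (mixture k mu) <=
    ((n - k + 1)%:R^-1)%:E *
      \sum_(1 <= i < k.+1)
        mutual_information (block X 1 (i - 1)) (block X k (n - k + 1)).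
Proof.
case: n X hX hk => [|n] X hX hk; first by lia.
rewrite sum_mutual_informationE; last by lia.
set M := (n.+1 - k + 1)%N.
pose I (a : nat) := relative_entropy (block_law X a M)
  (distribution P (block X 1 a) \x distribution P (last_block X M)).
rewrite [X in _ * X](_ : _ = \sum_(a < k) I a)//.
have I0 a : 0 <= I a by exact: relative_entropy_ge0.
have S0 : 0 <= \sum_(a < k) I a by exact: sume_ge0.
have M0 : (0 < M)%N by rewrite /M; lia.
have Mi0 : (0 < (M%:R^-1 : R))%R by rewrite invr_gt0 ltr0n.
(* If the bound is infinite, any mixing measure will do. *)
have [Soo|Sfin] := eqVneq (\sum_(a < k) I a) +oo.
  exists (\d_(point : pprobability A R)).
  by rewrite Soo gt0_muley ?lte_fin// leey.
have Ifin a : (a < k)%N -> I a \is a fin_num.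
  move=> ak; rewrite ge0_fin_numE// (@le_lt_trans _ _ (\sum_(a < k) I a))//.
    by rewrite (bigD1 (Ordinal ak))//= leeDl// sume_ge0.
  by rewrite ltey.
have [k1|k1] := leqP k 1.
  have [mu muE] : exists mu : probability (pprobability A R) R,
      relative_entropy (distribution P (block X 1 k)) (mixture k mu) <= 0.
    by rewrite (_ : k = 1%N); [exact: exists_mixture1|lia].
  exists mu; apply: (le_trans muE).
  by rewrite mule_ge0// lee_fin ltW.
(* From a <= k - 1 and m <= n + 1 - k, the first a and the last m + 1 entries do not overlap. *)
have kM a m : (a < k)%N -> (m < M)%N -> (a + m < n.+1)%N by rewrite /M; lia.
have mn m : (m < M)%N -> (m < n.+1)%N by rewrite /M; lia.
have [|||||||m mM [mu muP]] := @exists_mixture _ A R (block_law X)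
  (fun a => distribution P (block X 1 a))
  (fun m => distribution P (last_block X m)) k M _ _ _ _ _ _ _ k1 M0.
- exact: ltnW.
- by move=> a m ak mM B mB; rewrite block_law_drop// mn.
- by move=> a m ak mM B mB; rewrite (block_law_shift hX)// kM.
- move=> m mM B mB; rewrite /distribution /pushforward; congr (P _).
  by apply/seteqP; split => w; rewrite /= tuple_behead_last_block ?mn.
- by move=> a m ak mM B mB.
(* Finite information gives absolute continuity for the longest block, which passes to shorter
   ones. *)
- move=> a m ak mM; apply: (block_law_dominates _ mM); first by rewrite /M; lia.
  exact: relative_entropy_fin_dominates (Ifin _ ak).
- by move=> a ak; exact: Ifin.
exists mu; apply: (muP _ _ P (block X 1 k) (last_block X m)) => //.
Qed.
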